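(* Let $0\le k\le \ell$ be integers, and let $\mathbb{E}[\ell,k]=\binom{\ell}{k}^{-1}\sum_{\mathbf{b}\in B_{\ell,k}} r(\mathbf{b})$ be the expected length of the right lane of a uniformly random arrival sequence of length $\ell$ with exactly $k$ zeros. Then $$\mathbb{E}[\ell,k]=\left[\frac{\ell+1}{2}\binom{\ell}{k}+\sum_{i=0}^{\lfloor k/2-1\rfloor}\binom{\ell}{k-2i-2}\right]\Big/\binom{\ell}{k}\quad\text{for } \ell\ge 2k+1 \text{ and } \ell \text{ odd},$$ $$\mathbb{E}[\ell,k]=\left[\frac{\ell}{2}\binom{\ell}{k}+\sum_{i=0}^{\lfloor (k-1)/2\rfloor}\binom{\ell}{k-2i-1}\right]\Big/\binom{\ell}{k}\quad\text{for } \ell\ge 2k \text{ and } \ell \text{ even},$$ and $$\mathbb{E}[\ell,k]=\left[k\binom{\ell}{k}+\sum_{i=0}^{\lfloor(\ell-k-1)/2\rfloor}\binom{\ell}{k+2i+1}\right]\Big/\binom{\ell}{k}\quad\text{for } \ell<2k.$$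
   Context: An arrival sequence of length $\ell$ is a binary string $\mathbf{b}=b_1b_2\cdots b_\ell\in\{0,1\}^\ell$; $B_{\ell,k}$ is the set of those with exactly $k$ zeros (zeros are called red cars). Cars $1,2,\dots,\ell$ arrive in order and choose between two initially empty lanes (left and right): if $b_i=0$, car $i$ enters the right lane; if $b_i=1$, car $i$ enters the currently shorter lane, and enters the right lane if both lanes have the same length. $r(\mathbf{b})$ denotes the final number of cars in the right lane. A sum whose upper limit is $-1$ is empty (equal to $0$). *)

(* Defs.v *)
From mathcomp Require Import all_boot all_order all_algebra.

Set Implicit Arguments.
Unset Strict Implicit.
Unset Printing Implicit Defensive.

Import Order.TTheory GRing.Theory Num.Theory.
Local Open Scope ring_scope.

(* In an arrival sequence the letter 0 (a red car) is [false]
   and the letter 1 is [true]. *)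
Definition arrivals (l k : nat) : {set l.-tuple bool} :=
  [set b : l.-tuple bool | count_mem false b == k].

(* A state is the pair (cars in the left lane, cars in the right lane). *)
Definition arrive (s : nat * nat) (c : bool) : nat * nat :=
  if c && (s.1 < s.2)%N then (s.1.+1, s.2) else (s.1, s.2.+1).

Definition lanes (b : seq bool) : nat * nat := foldl arrive (0%N, 0%N) b.

Definition right_lane (b : seq bool) : nat := (lanes b).2.

Definition expected_right (l k : nat) : rat :=
  'C(l, k)%:R^-1 * \sum_(b in arrivals l k) (right_lane b)%:R.

(* Main.v *)
(* Let S be the walk with a step +1 for each red car and -1 for each other car,
   and let M be the opposite of its minimum.  The right lane exceeds the left one
   by S reflected at 0, where each reflection adds 2 to S and pushes the barrier
   down by 2; hence r(b) = k + ceil(M / 2), i.e. the sum over j of the indicators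
   of M >= 2j + 1 is r(b) - k.  By the reflection principle, the number of
   sequences with M >= m is C(l, k + m) or C(l, k), according to whether the
   endpoint 2k - l is above or below -m. *)
Require Import Defs.
From mathcomp Require Import all_boot all_order all_algebra.
From mathcomp Require Import zify ring.

Import Order.TTheory GRing.Theory Num.Theory.
Local Open Scope ring_scope.

Lemma big_tuple_cons (R : Type) (idx : R) (op : Monoid.com_law idx)
    (T : finType) (n : nat) (P : pred (seq T)) (F : seq T -> R) :
  \big[op/idx]_(t : n.+1.-tuple T | P t) F t =
  \big[op/idx]_(x : T) \big[op/idx]_(t : n.-tuple T | P (x :: t)) F (x :: t).
Proof.
rewrite pair_big_dep /=.
rewrite (reindex (fun p : T * n.-tuple T => cons_tuple p.1 p.2)) //=.
exists (fun t : n.+1.-tuple T => (thead t, behead_tuple t)) => [[x t] _|t _] /=.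
  by congr pair; apply/val_inj.
by rewrite [in RHS](tuple_eta t); apply/val_inj.
Qed.

Lemma sum_nat_trunc (m n : nat) (F : nat -> nat) :
    (m <= n)%N -> (forall j, (m <= j)%N -> F j = 0%N) ->
  (\sum_(0 <= j < n) F j = \sum_(0 <= j < m) F j)%N.
Proof.
move=> le_mn F0; rewrite (big_cat_nat _ le_mn) //=.
rewrite [X in (_ + X)%N]big_nat_cond [X in (_ + X)%N]big1 ?addn0 //.
by move=> j /andP[/andP[/F0]].
Qed.

(* The number of walks with l steps, k of them up, whose minimum is at most -m. *)
Definition walks_below (m l k : nat) : nat :=
  if (l <= 2 * k + m)%N then 'C(l, k + m) else 'C(l, k).

Lemma walks_below0 l k : walks_below 0 l k = 'C(l, k).
Proof. by rewrite /walks_below !addn0 if_same. Qed.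

Lemma walks_below_small m l k : (l < m)%N -> walks_below m l k = 0%N.
Proof. by move=> lt_lm; rewrite /walks_below ifT ?bin_small //; lia. Qed.

(** After an up step the rest of the walk must descend [m + 2], after a down step only [m]. The
    endpoint is on the same side of the level in all three terms, so Pascal's rule applies in either
    case. *)
Lemma walks_belowSS m l k :
  walks_below m.+1 l.+1 k.+1 = (walks_below m.+2 l k + walks_below m l k.+1)%N.
Proof.
rewrite /walks_below.
have -> : (l <= 2 * k + m.+2)%N = (l.+1 <= 2 * k.+1 + m.+1)%N by lia.
have -> : (l <= 2 * k.+1 + m)%N = (l.+1 <= 2 * k.+1 + m.+1)%N by lia.
case: ifP => _; last by rewrite binS addnC.
by rewrite addSnnS !addnS addSn binS.
Qed.

Lemma walks_belowS0 m l : walks_below m.+1 l.+1 0 = walks_below m l 0.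
Proof.
rewrite /walks_below !muln0 !add0n ltnS !bin0.
by case: ifP => // le_lm; rewrite binS bin_small ?ltnS.
Qed.

(** An index shift, lossless because no walk of [l] steps descends [2n > l]. It expresses the
    reflection at equal lanes. *)
Lemma sum_walks_below_even n l k : (l < n.*2)%N ->
  (\sum_(0 <= j < n) walks_below (2 * j) l k =
   'C(l, k) + \sum_(0 <= j < n) walks_below (2 * j).+2 l k)%N.
Proof.
case: n => // n lt_ln; rewrite big_nat_recl // muln0 walks_below0.
rewrite [in RHS]big_nat_recr //= [X in (_ + (_ + X))%N]walks_below_small; last lia.
by rewrite addn0; congr addn; apply: eq_bigr => j _; congr walks_below; lia.
Qed.

(** Allowing an initial lead [d] of the right lane makes induction on the first car possible: levels
    are now counted from height [d]. Terms with [j >= l] vanish, so [n] can stay fixed while [l]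
    decreases. *)
Lemma sum_foldl_arrive (l k a d n : nat) : (l <= n)%N ->
  (\sum_(b : l.-tuple bool | count_mem false b == k)
      (foldl arrive (a, a + d) b).2 =
   (a + d + k) * 'C(l, k) + \sum_(0 <= j < n) walks_below (d + 2 * j).+1 l k)%N.
Proof.
elim: l k a d => [|l IHl] k a d le_ln.
  rewrite [X in _ = (_ + X)%N]big1 => [|j _]; last by rewrite walks_below_small.
  case: k => [|k]; last by rewrite big_pred0 ?muln0 // => b; rewrite tuple0.
  rewrite (big_pred1 [tuple]) => [|b]; last by rewrite tuple0 [RHS]eqxx.
  by rewrite bin0 muln1 !addn0.
have le_l_n := ltnW le_ln.
have red_first q : (\sum_(t : l.-tuple bool | count_mem false t == q)
    (foldl arrive (a, (a + d).+1) t).2 = (a + d + q.+1) * 'C(l, q) +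
    \sum_(0 <= j < n) walks_below (d + 2 * j).+2 l q)%N.
  by rewrite -addnS IHl // addnS addSnnS.
have other_first q : (\sum_(t : l.-tuple bool | count_mem false t == q)
    (foldl arrive (if (a < a + d)%N then (a.+1, a + d) else (a, (a + d).+1)) t).2
    = (a + d + q) * 'C(l, q) +
    \sum_(0 <= j < n) walks_below (d + 2 * j) l q)%N.
  (* At equal lanes the car goes right although the walk steps down: the new lead is 1, and the
     extra car in each sequence is the level-0 term ['C(l, q)]. *)
  case: d {red_first} => [|d].
    rewrite addn0 ltnn -addn1 IHl //.
    under [in RHS]eq_bigr do rewrite add0n.
    rewrite sum_walks_below_even; last lia.
    by rewrite addn1 addSn mulSnr -addnA.
  rewrite ifT; last lia.
  by rewrite -addSnnS IHl.
rewrite (big_tuple_cons _ _ _ _ _ (fun b => count_mem false b == k)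
  (fun b => (foldl arrive (a, a + d)%N b).2)) big_bool /= /arrive /=.
under eq_bigl do rewrite add0n.
rewrite other_first.
case: k => [|k].
  rewrite [X in (_ + X)%N = _]big_pred0 // addn0 !bin0; congr addn.
  by apply: eq_bigr => j _; rewrite walks_belowS0.
rewrite [X in (_ + X)%N = _](eq_bigl (fun t => count_mem false (val t) == k)) //.
rewrite red_first binS.
under [in RHS]eq_bigr do rewrite walks_belowSS.
by rewrite big_split /=; ring.
Qed.

Lemma sum_right_lane (l k n : nat) : (l <= n)%N ->
  (\sum_(b in arrivals l k) right_lane b =
   k * 'C(l, k) + \sum_(0 <= j < n) walks_below (2 * j).+1 l k)%N.
Proof.
move=> le_ln; rewrite (eq_bigl (fun b => count_mem false (val b) == k)).
  exact: (sum_foldl_arrive l k 0 0 n).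
by move=> b; rewrite inE.
Qed.

(** Separates the levels that every walk reaches because its endpoint is at or below them. *)
Lemma sum_walks_below_split (l k m n : nat) :
    (forall j, (j < m)%N -> walks_below (2 * j).+1 l k = 'C(l, k)) ->
  (\sum_(0 <= j < m + n) walks_below (2 * j).+1 l k =
   m * 'C(l, k) + \sum_(0 <= i < n) walks_below (2 * (m + i)).+1 l k)%N.
Proof.
move=> low; rewrite (big_cat_nat _ (leq_addr n m)) //=; congr addn.
  rewrite (eq_big_nat _ _ (F2 := fun=> 'C(l, k))) => [|j /andP[_ /low]//].
  by rewrite sum_nat_const_nat subn0.
rewrite -{1}[m]add0n big_addn addKn.
by apply: eq_bigr => i _; rewrite addnC.
Qed.

Lemma sum_right_lane_odd (h k : nat) : (k <= h)%N ->
  (\sum_(b in arrivals h.*2.+1 k) right_lane b =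
   h.+1 * 'C(h.*2.+1, k) + \sum_(0 <= i < k./2) 'C(h.*2.+1, k - 2 * i - 2))%N.
Proof.
(* The endpoint is [-(2(h - k) + 1)], so exactly the levels with [j <= h - k] are forced. *)
move=> le_kh; pose m := (h - k).+1.
rewrite (@sum_right_lane _ _ (m + h.*2.+1)) ?leq_addl //.
rewrite sum_walks_below_split => [|j lt_jm]; last first.
  (* At [j = h - k] the level is the endpoint itself, and both formulas agree by symmetry of
     binomials. *)
  rewrite /walks_below; case: ifP => // lel.
  by rewrite -bin_sub; [congr 'C(_, _)|]; lia.
rewrite addnA -mulnDl; congr (_ * _ + _)%N; first lia.
rewrite (@sum_nat_trunc k./2) => [||j lej]; [|lia|]; last first.
  by rewrite /walks_below ifT ?bin_small //; lia.
apply: eq_big_nat => i /andP[_ lti]; rewrite /walks_below ifT; last lia.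
by rewrite -bin_sub; [congr 'C(_, _)|]; lia.
Qed.

Lemma sum_right_lane_even (h k : nat) : (k <= h)%N ->
  (\sum_(b in arrivals h.*2 k) right_lane b =
   h * 'C(h.*2, k) + \sum_(0 <= i < k.+1./2) 'C(h.*2, k - 2 * i - 1))%N.
Proof.
(* The endpoint [-2(h - k)] is even and the levels are odd, so no boundary case arises. *)
move=> le_kh; pose m := (h - k)%N.
rewrite (@sum_right_lane _ _ (m + h.*2)) ?leq_addl //.
rewrite sum_walks_below_split => [|j lt_jm]; last first.
  by rewrite /walks_below ifF //; lia.
rewrite addnA -mulnDl; congr (_ * _ + _)%N; first lia.
rewrite (@sum_nat_trunc k.+1./2) => [||j lej]; [|lia|]; last first.
  by rewrite /walks_below ifT ?bin_small //; lia.
apply: eq_big_nat => i /andP[_ lti]; rewrite /walks_below ifT; last lia.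
by rewrite -bin_sub; [congr 'C(_, _)|]; lia.
Qed.

Lemma sum_right_lane_red (l k : nat) : (k <= l)%N -> (l < 2 * k)%N ->
  (\sum_(b in arrivals l k) right_lane b =
   k * 'C(l, k) + \sum_(0 <= i < (l - k).+1./2) 'C(l, k + 2 * i + 1))%N.
Proof.
move=> le_kl lt_l2k; rewrite (@sum_right_lane _ _ l) //; congr addn.
(* The endpoint is positive, so every level is reflected; terms vanish once [k + 2j + 1 > l]. *)
rewrite (@sum_nat_trunc (l - k).+1./2) => [||j lej]; [|lia|]; last first.
  by rewrite /walks_below ifT ?bin_small //; lia.
apply: eq_big_nat => i _; rewrite /walks_below ifT; last lia.
by congr 'C(_, _); lia.
Qed.

(* A sum with upper limit floor(x) has floor(x) + 1 terms:
   k./2 for x = k/2 - 1, (k.+1)./2 for x = (k-1)/2, and (l-k).+1./2 for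
   x = (l-k-1)/2; every truncated subtraction below is exact in its range. *)
Theorem theorem4p9 (l k : nat) (hkl : (k <= l)%N) :
  [/\ (2 * k + 1 <= l)%N -> odd l ->
        expected_right l k =
          ((l%:R + 1) / 2%:R * 'C(l, k)%:R
             + \sum_(0 <= i < k./2) 'C(l, k - 2 * i - 2)%:R) / 'C(l, k)%:R,
      (2 * k <= l)%N -> ~~ odd l ->
        expected_right l k =
          (l%:R / 2%:R * 'C(l, k)%:R
             + \sum_(0 <= i < k.+1./2) 'C(l, k - 2 * i - 1)%:R) / 'C(l, k)%:R
    & (l < 2 * k)%N ->
        expected_right l k =
          (k%:R * 'C(l, k)%:R
             + \sum_(0 <= i < (l - k).+1./2) 'C(l, k + 2 * i + 1)%:R)
            / 'C(l, k)%:R].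
Proof.
have expE : expected_right l k =
    (\sum_(b in arrivals l k) right_lane b)%N%:R / 'C(l, k)%:R.
  by rewrite /expected_right mulrC natr_sum.
split=> [le_kl odd_l|le_kl even_l|lt_lk]; rewrite {}expE; congr (_ / _).
- have -> : l = l./2.*2.+1 by lia.
  rewrite sum_right_lane_odd; last lia.
  rewrite natrD natrM natr_sum; congr (_ * _ + _).
  by rewrite -natr1 -[in RHS]natr1 -muln2 natrM; field.
- have -> : l = l./2.*2 by lia.
  rewrite sum_right_lane_even; last lia.
  rewrite natrD natrM natr_sum; congr (_ * _ + _).
  by rewrite -[in RHS]muln2 natrM; field.
- by rewrite sum_right_lane_red // natrD natrM natr_sum.
Qed.
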